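(* For every $n\ge1$, the classical Krull dimension of $\mathbb{S}_n$ is $2n$.
   Context: $K$ is a field. $\mathbb{S}_n$ is the $K$-algebra generated by $x_1,\dots,x_n,y_1,\dots,y_n$ subject to the defining relations $y_ix_i=1$ for all $i$, and $[x_i,y_j]=[x_i,x_j]=[y_i,y_j]=0$ for all $i\ne j$. The classical Krull dimension of a ring is the supremum of lengths $s$ of strictly ascending chains $\mathfrak p_0\subset\mathfrak p_1\subset\cdots\subset\mathfrak p_s$ of (two-sided) prime ideals. *)

(* Defs.v *)
From HB Require Import structures.
From mathcomp Require Import all_boot all_order all_algebra.
Set Implicit Arguments. Unset Strict Implicit. Unset Printing Implicit Defensive.
Import GRing.Theory.
Local Open Scope ring_scope.

Section Jacobson.
Variables (K : fieldType).

Definition jacobson_relations (n : nat) (B : algType K)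
    (x y : 'I_n -> B) : Prop :=
  (forall i, y i * x i = 1) /\
  (forall i j, i != j ->
     [/\ x i * y j = y j * x i,
         x i * x j = x j * x i &
         y i * y j = y j * y i]).

Definition is_alg_hom (A B : algType K) (f : A -> B) : Prop :=
  [/\ forall a b, f (a + b) = f a + f b,
      forall a b, f (a * b) = f a * f b,
      f 1 = 1 &
      forall (k : K) a, f (k *: a) = k *: f a].

(* A (with the elements x, y) is the K-algebra generated by x_i, y_i subject
   to the defining relations of S_n, i.e. it satisfies the universal property
   of the presentation. *)
Definition is_S_n (n : nat) (A : algType K) (x y : 'I_n -> A) : Prop :=
  jacobson_relations x y /\
  forall (B : algType K) (bx by_ : 'I_n -> B),
    jacobson_relations bx by_ ->
    (exists f : A -> B, is_alg_hom f /\ forall i, f (x i) = bx i /\ f (y i) = by_ i) /\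
    (forall f g : A -> B, is_alg_hom f -> is_alg_hom g ->
       (forall i, f (x i) = g (x i) /\ f (y i) = g (y i)) ->
       forall a, f a = g a).

End Jacobson.

Section Prime.
Variable (R : ringType).

Definition is_ideal (I : R -> Prop) : Prop :=
  [/\ I 0,
      forall a b, I a -> I b -> I (a - b),
      forall r a, I a -> I (r * a) &
      forall r a, I a -> I (a * r)].

Definition is_prime_ideal (P : R -> Prop) : Prop :=
  [/\ is_ideal P,
      ~ P 1 &
      forall I J : R -> Prop, is_ideal I -> is_ideal J ->
        (forall a b, I a -> J b -> P (a * b)) ->
        (forall a, I a -> P a) \/ (forall b, J b -> P b)].

Definition strict_subset (P Q : R -> Prop) : Prop :=
  (forall a, P a -> Q a) /\ exists a, Q a /\ ~ P a.

Definition has_prime_chain (s : nat) : Prop :=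
  exists p : nat -> R -> Prop,
    (forall k, (k <= s)%N -> is_prime_ideal (p k)) /\
    (forall k, (k < s)%N -> strict_subset (p k) (p k.+1)).

Definition classical_Krull_dim_eq (d : nat) : Prop :=
  has_prime_chain d /\ forall s, has_prime_chain s -> (s <= d)%N.

End Prime.

(* Main.v *)
Require Import Defs.
From HB Require Import structures.
From mathcomp Require Import all_boot all_order all_algebra.
From mathcomp Require Import boolp zify.
Set Implicit Arguments. Unset Strict Implicit. Unset Printing Implicit Defensive.
Import GRing.Theory.
Local Open Scope ring_scope.

(** Put [e_i := 1 - x_i y_i].  Since [e_i x_i = y_i e_i = 0], a prime [P] avoiding
    [e_i] is determined by its elements not involving [x_i, y_i]; if [e_i] is in
    [P], then [x_i] is central and invertible modulo [P].  So if two primes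
    [P < Q] contain the same [e_i], then [Q] contains, and [P] does not, some
    polynomial in those [x_i] for which [e_i] lies in [P], and this polynomial is
    central modulo [P].
    In a chain of length greater than [2n] at most [n] steps enlarge the set of
    [e_i], so more than [n] steps yield such a polynomial.  Counting monomials, these
    polynomials satisfy a nontrivial algebraic relation over [K], and reducing it
    modulo the successive primes, starting with the smallest exponents, makes
    all of its coefficients vanish.
    Conversely, adding [e_0, x_0 - 1, e_1, x_1 - 1, ...] one at a time gives a chain
    of [2n + 1] primes.  Each is the annihilator of a module over [K(t)] with basis
    the multi-indices in the variables not yet involved, on which these variables act
    by shifts, while the other [x_i] act by [1] or, for at most one of them, by [t];
    it is prime because every matrix unit of the module is realised by the algebra. *)

(** * Words in the generators *)

Section Words.
Variables (K : fieldType) (n : nat) (A : algType K) (x y : 'I_n -> A).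

(** The subalgebra generated by the [x i] and [y i] with [i] in [S]. Generators multiply on the left
    only, so that inductions peel off one letter at a time. *)
Inductive gen (S : {set 'I_n}) : A -> Prop :=
| gen1 : gen S 1
| genX i u : i \in S -> gen S u -> gen S (x i * u)
| genY i u : i \in S -> gen S u -> gen S (y i * u)
| genZ k u : gen S u -> gen S (k *: u)
| genD u v : gen S u -> gen S v -> gen S (u + v).

Lemma gen0 S : gen S 0.
Proof. by rewrite -(scale0r (1 : A)); apply/genZ/gen1. Qed.

Lemma genM S u v : gen S u -> gen S v -> gen S (u * v).
Proof.
move=> hu hv; elim: hu => {u} [|i u iS _ IH|i u iS _ IH|k u _ IH|u w _ IHu _ IHw].
- by rewrite mul1r.
- by rewrite -mulrA; apply: genX.
- by rewrite -mulrA; apply: genY.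
- by rewrite -scalerAl; apply: genZ.
- by rewrite mulrDl; apply: genD.
Qed.

Lemma gen_x (S : {set 'I_n}) i : i \in S -> gen S (x i).
Proof. by move=> iS; rewrite -[x i]mulr1; apply/genX/gen1. Qed.

Lemma gen_y (S : {set 'I_n}) i : i \in S -> gen S (y i).
Proof. by move=> iS; rewrite -[y i]mulr1; apply/genY/gen1. Qed.

Lemma gen_xX (S : {set 'I_n}) i a : i \in S -> gen S (x i ^+ a).
Proof.
by move=> iS; elim: a => [|a IH]; rewrite ?expr0 ?exprS; [apply: gen1|apply: genX].
Qed.

Lemma gen_yX (S : {set 'I_n}) i a : i \in S -> gen S (y i ^+ a).
Proof.
by move=> iS; elim: a => [|a IH]; rewrite ?expr0 ?exprS; [apply: gen1|apply: genY].
Qed.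

Definition genpred : {pred A} := [pred u | `[< gen setT u >]].

Lemma genpredP u : reflect (gen setT u) (u \in genpred).
Proof. exact: asboolP. Qed.

Lemma genpred_subalg : GRing.subalg_closed genpred.
Proof.
split=> [|k u v /genpredP hu /genpredP hv|u v /genpredP hu /genpredP hv];
  apply/genpredP.
- exact: gen1.
- by apply: genD hv; apply: genZ.
- exact: genM.
Qed.
HB.instance Definition _ := GRing.isSubalgClosed.Build K A genpred genpred_subalg.

Record gensub := Gensub { gensub_val : A; _ : gensub_val \in genpred }.
HB.instance Definition _ := [isSub for gensub_val].
HB.instance Definition _ := [Choice of gensub by <:].
HB.instance Definition _ := [SubChoice_isSubAlgebra of gensub by <:].

(* The subalgebra of words satisfies the same relations, so [A] maps to it, and the
   composite with the inclusion is the identity of [A]. *)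
Lemma gen_full : is_S_n x y -> forall a, gen setT a.
Proof.
move=> [[yx cm] univ] a.
have mx i : x i \in genpred by apply/genpredP/gen_x.
have my i : y i \in genpred by apply/genpredP/gen_y.
pose sx i : gensub := Gensub (mx i); pose sy i : gensub := Gensub (my i).
have rel : jacobson_relations sx sy.
  split=> [i|i j /cm[h1 h2 h3]]; first by apply: val_inj; rewrite /= yx.
  by split; apply: val_inj.
have [[f [[fD fM f1 fZ] fxy]] _] := univ _ sx sy rel.
have [_ uniq] := univ _ x y (conj yx cm).
pose g u : A := val (f u).
have gE : g a = a.
  apply: (uniq g id) => // [|i]; last by have [h1 h2] := fxy i; rewrite /g h1 h2.
  by split=> *; rewrite /g ?fD ?fM ?f1 ?fZ.
by rewrite -gE; apply/genpredP/(valP (f a)).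
Qed.

End Words.

(** * Prime ideals *)

Section PrimeIdeals.
Variable R : nzRingType.

Lemma idealD (P : R -> Prop) a b : is_ideal P -> P a -> P b -> P (a + b).
Proof.
move=> [P0 PB _ _] Pa Pb.
by rewrite -[b]opprK -[- b]sub0r; apply: (PB) => //; apply: PB.
Qed.

(** Primeness is applied to the ideal of all [u] with [u R b] inside [P], which contains [a], and
    the ideal of all [v] with [u R v] inside [P] for every such [u], which contains [b]. *)
Lemma prime_elem (P : R -> Prop) a b :
  is_prime_ideal P -> (forall r, P (a * r * b)) -> P a \/ P b.
Proof.
move=> [[P0 PB Pl Pr] _ prP] Pab.
pose I u := forall r, P (u * r * b).
pose J v := forall u r, I u -> P (u * r * v).
have idI : is_ideal I.
  split=> [r|u v Iu Iv r|s u Iu r|s u Iu r].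
  - by rewrite !mul0r.
  - by rewrite !mulrBl; apply: PB.
  - by rewrite -!mulrA; apply: Pl; rewrite mulrA.
  - by rewrite -(mulrA u).
have idJ : is_ideal J.
  split=> [u r _|v w Jv Jw u r Iu|s v Jv u r Iu|s v Jv u r Iu].
  - by rewrite mulr0.
  - by rewrite mulrBr; apply: PB; [apply: Jv|apply: Jw].
  - by rewrite mulrA -(mulrA u); apply: Jv.
  - by rewrite mulrA; apply: Pr; apply: Jv.
have [u v Iu Jv|h|h] := prP I J idI idJ.
- by rewrite -[u]mulr1; apply: Jv.
- by left; apply: h.
- by right; apply: h => u r; apply.
Qed.

Lemma prime_notin (P : R -> Prop) a b :
  is_prime_ideal P -> ~ P a -> ~ P b -> exists r, ~ P (a * r * b).
Proof.
move=> prP Pa Pb; apply: contrapT => /forallNP h.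
by have [r| |] := @prime_elem P a b prP; first exact: contrapT (h r).
Qed.

Definition central_mod (P : R -> Prop) a := forall v, P (a * v - v * a).

Lemma central_mod1 (P : R -> Prop) : is_ideal P -> central_mod P 1.
Proof. by move=> [P0 _ _ _] v; rewrite mul1r mulr1 subrr. Qed.

Lemma central_modD (P : R -> Prop) a b : is_ideal P ->
  central_mod P a -> central_mod P b -> central_mod P (a + b).
Proof.
move=> idP Pa Pb v; rewrite mulrDl mulrDr opprD addrACA.
exact: idealD.
Qed.

Lemma central_modM (P : R -> Prop) a b : is_ideal P ->
  central_mod P a -> central_mod P b -> central_mod P (a * b).
Proof.
move=> idP Pa Pb v.
have -> : a * b * v - v * (a * b) = a * (b * v - v * b) + (a * v - v * a) * b.
  by rewrite mulrBr mulrBl !mulrA addrA subrK.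
by case: (idP) => _ _ Pl Pr; apply: idealD => //; [apply: Pl|apply: Pr].
Qed.

(** Modulo [P] one has [a r b = r a b], so [a R b] lies in [P] as soon as [a b] does. *)
Lemma prime_central (P : R -> Prop) a b : is_prime_ideal P ->
  central_mod P a -> ~ P a -> P (a * b) -> P b.
Proof.
move=> prP Pa nPa Pab; have [idP _ _] := prP.
case: (prime_elem prP (a := a) (b := b)) => // r; case: (idP) => _ _ Pl _.
rewrite -[a * r](subrK (r * a)) mulrDl; apply: idealD => //.
  by case: (idP) => _ _ _; apply; apply: Pa.
by rewrite -mulrA; apply: Pl.
Qed.

End PrimeIdeals.

(** * Eliminating the generators whose idempotent avoids the primes *)

Section Reduction.
Variables (K : fieldType) (n : nat) (A : algType K) (x y : 'I_n -> A).
Hypothesis rel : jacobson_relations x y.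
Hypothesis genA : forall a, gen x y setT a.

Local Notation gen := (gen x y).

Let yx i : y i * x i = 1. Proof. by case: rel. Qed.
Let cxy i j : i != j -> x i * y j = y j * x i.
Proof. by case: rel => _ h /h[]. Qed.
Let cxx i j : x i * x j = x j * x i.
Proof. by case: (eqVneq i j) => [->//|/(proj2 rel)[]]. Qed.
Let cyy i j : y i * y j = y j * y i.
Proof. by case: (eqVneq i j) => [->//|/(proj2 rel)[]]. Qed.

Lemma idealZ (P : A -> Prop) k a : is_ideal P -> P a -> P (k *: a).
Proof. by move=> [_ _ Pl _] Pa; rewrite -mulr_algl; apply: Pl. Qed.

Lemma yXxX i a : y i ^+ a * x i ^+ a = 1.
Proof.
elim: a => [|a IH]; first by rewrite !expr0 mulr1.
by rewrite exprSr exprS mulrA -(mulrA (_ ^+ a)) yx mulr1 IH.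
Qed.

Lemma gen_commx (S : {set 'I_n}) i u : i \notin S -> gen S u -> GRing.comm u (x i).
Proof.
move=> iS; elim=> {u} [|j u jS _ IH|j u jS _ IH|k u _ IH|u v _ IHu _ IHv].
- exact/commr_sym/commr1.
- by apply/commr_sym/commrM; [apply: cxx|apply/commr_sym].
- apply/commr_sym/commrM; last exact/commr_sym.
  by apply: cxy; apply: contraNneq iS => ->.
- by rewrite /GRing.comm -scalerAl -scalerAr IH.
- by apply/commr_sym/commrD; apply/commr_sym.
Qed.

Lemma gen_commy (S : {set 'I_n}) i u : i \notin S -> gen S u -> GRing.comm u (y i).
Proof.
move=> iS; elim=> {u} [|j u jS _ IH|j u jS _ IH|k u _ IH|u v _ IHu _ IHv].
- exact/commr_sym/commr1.
- apply/commr_sym/commrM; last exact/commr_sym.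
  by apply/commr_sym/cxy; apply: contraNneq iS => <-.
- by apply/commr_sym/commrM; [apply: cyy|apply/commr_sym].
- by rewrite /GRing.comm -scalerAl -scalerAr IH.
- by apply/commr_sym/commrD; apply/commr_sym.
Qed.

Definition e i : A := 1 - x i * y i.

Lemma gen_comme (S : {set 'I_n}) i u : i \notin S -> gen S u -> GRing.comm u (e i).
Proof.
move=> iS gu; apply: commrB; first exact: commr1.
by apply: commrM; [apply: gen_commx gu|apply: gen_commy gu].
Qed.

Lemma ex i : e i * x i = 0.
Proof. by rewrite mulrBl mul1r -mulrA yx mulr1 subrr. Qed.

Lemma ye i : y i * e i = 0.
Proof. by rewrite mulrBr mulr1 mulrA yx mul1r subrr. Qed.

Lemma ee i : e i * e i = e i.
Proof. by rewrite {2}/e mulrBr mulr1 mulrA ex mul0r subr0. Qed.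

Lemma exX i a : e i * x i ^+ a.+1 = 0.
Proof. by rewrite exprS mulrA ex mul0r. Qed.

Lemma yXe i a : y i ^+ a.+1 * e i = 0.
Proof. by rewrite exprSr -mulrA ye mulr0. Qed.

(* As [y_i x_i = 1], every word can be rewritten with its [x_i] on the left and its
   [y_i] on the right. *)
Inductive nf (S : {set 'I_n}) (i : 'I_n) : A -> Prop :=
| nf_term a v b : gen (S :\ i) v -> nf S i (x i ^+ a * v * y i ^+ b)
| nf_add u v : nf S i u -> nf S i v -> nf S i (u + v).

Lemma gen_nf S i u : gen S u -> nf S i u.
Proof.
have iSi : i \notin S :\ i by rewrite !inE eqxx.
elim=> {u} [|j u jS _|j u jS _|k u _|u v _ IHu _ IHv]; last exact: nf_add.
- have -> : 1 = x i ^+ 0 * 1 * y i ^+ 0 by rewrite !expr0 !mulr1.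
  by apply: nf_term; apply: gen1.
- elim=> {u} [a v b gv|u v _ IHu _ IHv]; last by rewrite mulrDr; apply: nf_add.
  rewrite !mulrA; case: (eqVneq j i) => [->|ji].
    by rewrite -exprS; apply: nf_term.
  rewrite (commrX _ (cxx j i)) -(mulrA _ (x j)); apply: nf_term.
  by apply: genX => //; rewrite !inE ji.
- elim=> {u} [a v b gv|u v _ IHu _ IHv]; last by rewrite mulrDr; apply: nf_add.
  rewrite !mulrA; case: (eqVneq j i) => [->|ji].
    case: a => [|a]; last by rewrite exprS mulrA yx mul1r; apply: nf_term.
    rewrite expr0 mulr1 -(gen_commy iSi gv) -mulrA -exprS -[v]mul1r.
    by rewrite -[1](expr0 (x i)); apply: nf_term.
  have cji : GRing.comm (y j) (x i) by apply/commr_sym/cxy; rewrite eq_sym.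
  rewrite (commrX _ cji) -(mulrA _ (y j)); apply: nf_term.
  by apply: genY => //; rewrite !inE ji.
- elim=> {u} [a v b gv|u v _ IHu _ IHv]; last by rewrite scalerDr; apply: nf_add.
  by rewrite scalerAl scalerAr; apply: nf_term; apply: genZ.
Qed.

Lemma gen_nf_ind (S : {set 'I_n}) i (Q : A -> Prop) u :
  (forall a v b, gen (S :\ i) v -> Q (x i ^+ a * v * y i ^+ b)) ->
  (forall u v, Q u -> Q v -> Q (u + v)) -> gen S u -> Q u.
Proof.
move=> Qt Qd /(gen_nf i) nu; elim: nu => [a v b|v w _ Qv _ Qw]; first exact: Qt.
exact: Qd.
Qed.

Section OnePrime.
Variables (P : A -> Prop) (i : 'I_n).
Hypotheses (prP : is_prime_ideal P) (Pe : ~ P (e i)).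

Let idP : is_ideal P. Proof. by case: prP. Qed.

(* Left and right multiplication by [e i] kills every monomial except those
   which start with [y i] on the left and end with [x i] on the right. *)
Lemma corner_notin w : ~ P w ->
  exists b c, ~ P (e i * y i ^+ b * w * x i ^+ c * e i).
Proof.
have iT : i \notin [set: 'I_n] :\ i by rewrite !inE eqxx.
move=> Pw; have [r hr] := prime_notin prP Pe Pw.
have [b hb] : exists b, ~ P (e i * y i ^+ b * w).
  apply: contrapT => /forallNP h; apply: hr.
  apply: (gen_nf_ind (i := i) (Q := fun r => P (e i * r * w)) _ _ (genA r))
    => /= [a v b gv|u v].
    case: a => [|a]; last by rewrite !mulrA exX !mul0r; case: idP.
    rewrite expr0 mul1r mulrA -(gen_comme iT gv) -!mulrA.
    by case: (idP) => _ _ Pl _; apply: Pl; rewrite mulrA; exact: contrapT (h _).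
  by move=> Pu Pv; rewrite (mulrDr _ u v) mulrDl; apply: (idealD idP).
have [s hs] := prime_notin prP hb Pe.
suff [c hc] : exists c, ~ P (e i * y i ^+ b * w * x i ^+ c * e i) by exists b, c.
apply: contrapT => /forallNP h; apply: hs.
apply: (gen_nf_ind (i := i) (Q := fun s => P (e i * y i ^+ b * w * s * e i)) _ _ (genA s))
  => /= [c v a gv|u v].
  case: a => [|a]; last by rewrite -!mulrA yXe !mulr0; case: idP.
  rewrite expr0 mulr1 mulrA -mulrA (gen_comme iT gv) mulrA.
  by case: (idP) => _ _ _; apply; exact: contrapT (h _).
by move=> Pu Pv; rewrite (mulrDr _ u v) mulrDl; apply: (idealD idP).
Qed.

(** For [r = x_i^a v y_i^b] the product [e_i r w] vanishes if [a > 0] and equals [v e_i w y_i^b] if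
    [a = 0], because [w] commutes with [y_i]. Hence [e_i A w] lies in the prime [P], which avoids
    [e_i]. *)
Lemma e_cancel (S : {set 'I_n}) w : i \notin S -> gen S w -> P (e i * w) -> P w.
Proof.
move=> iS gw Pew.
have iT : i \notin [set: 'I_n] :\ i by rewrite !inE eqxx.
case: (prime_elem prP (a := e i) (b := w)) => // r.
apply: (gen_nf_ind (i := i) (Q := fun r => P (e i * r * w)) _ _ (genA r))
    => /= [a v b gv|u v].
  case: a => [|a]; last by rewrite !mulrA exX !mul0r; case: idP.
  rewrite expr0 mul1r mulrA -(gen_comme iT gv) -!mulrA.
  rewrite -(commrX b (gen_commy iS gw)); case: (idP) => _ _ Pl Pr.
  by apply: Pl; rewrite mulrA; apply: Pr.
by move=> Pu Pv; rewrite mulrDr mulrDl; apply: (idealD idP).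
Qed.

End OnePrime.

(** Since [e_i x_i = y_i e_i = 0], only the normal-form terms with [a = b = 0] survive, and their
    [v] commutes with the idempotent [e_i]. *)
Lemma corner_gen (S : {set 'I_n}) i z : gen S z ->
  exists2 v, gen (S :\ i) v & e i * z * e i = e i * v.
Proof.
have iS : i \notin S :\ i by rewrite !inE eqxx.
apply: (@gen_nf_ind S i (fun z => exists2 v, gen (S :\ i) v & e i * z * e i = e i * v))
  => [a v b gv|u v [u' gu eu] [v' gv ev]]; last first.
  by exists (u' + v'); [apply: genD|rewrite (mulrDr _ u v) mulrDl eu ev (mulrDr _ u' v')].
case: a => [|a].
  case: b => [|b].
    by exists v => //; rewrite mul1r mulr1 -mulrA (gen_comme iS gv) mulrA ee.
  by exists 0; [apply: gen0|rewrite -!mulrA yXe !mulr0].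
by exists 0; [apply: gen0|rewrite !mulrA exX !mul0r mulr0].
Qed.

(* For [i] outside [C] an element [w] of [Q] not in [P] can be replaced by a corner
   [e_i y_i^b w x_i^c e_i], which has the form [e_i w'] with [w'] free of [x_i, y_i]. *)
Lemma prime_reduce (P Q : A -> Prop) (C : {set 'I_n}) u :
  is_prime_ideal P -> is_prime_ideal Q ->
  (forall i, i \notin C -> ~ P (e i) /\ ~ Q (e i)) ->
  Q u -> ~ P u -> exists w, [/\ gen C w, Q w & ~ P w].
Proof.
move=> prP prQ eC.
(* Induction on the number of indices of [S] outside [C]; each round eliminates one of them. *)
suff main m S w : #|S :\: C| = m -> C \subset S -> gen S w -> Q w -> ~ P w ->
    exists w, [/\ gen C w, Q w & ~ P w].
  by move=> Qu Pu; apply: (main _ setT u).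
elim: m S w => [|m IH] S w cSC CS gw Qw Pw.
  exists w; split=> //; suff -> : C = S by [].
  by apply/eqP; rewrite eqEsubset CS -setD_eq0 -cards_eq0 cSC.
have [i] : exists i, i \in S :\: C by apply/set0Pn; rewrite -cards_eq0 cSC.
rewrite inE => /andP[iC iS]; have [Pe Qe] := eC i iC.
have [b [c hbc]] := corner_notin prP Pe Pw.
have gz : gen S (y i ^+ b * w * x i ^+ c).
  by apply: genM; [apply: genM => //; apply: gen_yX|apply: gen_xX].
have [v gv ev] := corner_gen i gz.
have iSi : i \notin S :\ i by rewrite !inE eqxx.
apply: (IH (S :\ i) v _ _ gv).
- have := cardsD1 i (S :\: C); rewrite cSC inE iC iS => -[->].
  by congr #|pred_of_set _|; apply/setP=> k; rewrite !inE; case: (k == i);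
    rewrite // andbF.
- by rewrite subsetD1 CS.
- have [[_ _ Ql Qr] _ _] := prQ.
  apply: (e_cancel prQ Qe iSi gv); rewrite -ev; apply/Qr/Ql/Qr/Ql/Qw.
- move=> Pv; apply: hbc; have [[_ _ Pl _] _ _] := prP.
  rewrite -!mulrA; move: ev; rewrite -!mulrA => ->; exact: Pl.
Qed.

End Reduction.

(** * Polynomials in the x_i modulo a prime *)

Section Polynomials.
Variables (K : fieldType) (n : nat) (A : algType K) (x y : 'I_n -> A).
Hypothesis rel : jacobson_relations x y.
Hypothesis genA : forall a, gen x y setT a.

Local Notation gen := (gen x y).
Local Notation e := (e x y).

Let yx i : y i * x i = 1. Proof. by case: rel. Qed.
Let cxy i j : i != j -> x i * y j = y j * x i.
Proof. by case: rel => _ h /h[]. Qed.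
Let cxx i j : x i * x j = x j * x i.
Proof. by case: (eqVneq i j) => [->//|/(proj2 rel)[]]. Qed.

(** Polynomials in the [x i] with [i] in [S]; the number is only an upper bound for the degree. *)
Inductive polx (S : {set 'I_n}) : nat -> A -> Prop :=
| polx1 d : polx S d 1
| polxX d i u : i \in S -> polx S d u -> polx S d.+1 (x i * u)
| polxZ d k u : polx S d u -> polx S d (k *: u)
| polxD d u v : polx S d u -> polx S d v -> polx S d (u + v).

Lemma polx_le (S S' : {set 'I_n}) d d' v :
  S \subset S' -> (d <= d')%N -> polx S d v -> polx S' d' v.
Proof.
move=> /subsetP sS dd' pv; elim: pv d' dd' => {d v}
  [d|d i u iS _ IH|d k u _ IH|d u v _ IHu _ IHv] d' dd'.
- exact: polx1.
- by case: d' dd' => // d' dd'; apply: polxX; [apply: sS|apply: IH].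
- by apply: polxZ; apply: IH.
- by apply: polxD; [apply: IHu|apply: IHv].
Qed.

Lemma polxM S d d' u v : polx S d u -> polx S d' v -> polx S (d + d') (u * v).
Proof.
move=> pu pv; elim: pu => {d u} [d|d i u iS _ IH|d k u _ IH|d u w _ IHu _ IHw].
- by rewrite mul1r; apply: polx_le pv; rewrite // leq_addl.
- by rewrite -mulrA addSn; apply: polxX.
- by rewrite -scalerAl; apply: polxZ.
- by rewrite mulrDl; apply: polxD.
Qed.

Lemma polx_x (S : {set 'I_n}) i : i \in S -> polx S 1 (x i).
Proof. by move=> iS; rewrite -[x i]mulr1; apply/polxX/polx1. Qed.

Lemma polx_pow S d a u : polx S d u -> polx S (a * d) (u ^+ a).
Proof.
move=> pu; elim: a => [|a IH]; first by rewrite expr0; apply: polx1.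
by rewrite exprS mulSn; apply: polxM.
Qed.

Lemma polx_commx S d u i : polx S d u -> GRing.comm u (x i).
Proof.
elim=> {d u} [d|d j u jS _ IH|d k u _ IH|d u v _ IHu _ IHv].
- exact/commr_sym/commr1.
- by apply/commr_sym/commrM; [apply: cxx|apply/commr_sym].
- by rewrite /GRing.comm -scalerAl -scalerAr IH.
- by apply/commr_sym/commrD; apply/commr_sym.
Qed.

Lemma polx_comm S S' d d' u v : polx S d u -> polx S' d' v -> GRing.comm u v.
Proof.
move=> pu; elim=> {d' v} [d'|d' j v jS _ IH|d' k v _ IH|d' v w _ IHv _ IHw].
- exact: commr1.
- by apply: commrM => //; apply: polx_commx pu.
- by rewrite /GRing.comm -scalerAl -scalerAr IH.
- exact: commrD.
Qed.

(** Among the generators only [y i] may fail to commute with [x i], and modulo [e i] these two are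
    mutually inverse. *)
Lemma x_central (P : A -> Prop) i : is_ideal P -> P (e i) -> central_mod P (x i).
Proof.
move=> idP Pe v; have [P0 PB Pl Pr] := idP.
elim: (genA v) => {v} [|j v _ _ IH|j v _ _ IH|k v _ IH|u v _ IHu _ IHv].
- by rewrite mulr1 mul1r subrr.
- by rewrite mulrA cxx -!mulrA -mulrBr; apply: Pl.
- case: (eqVneq i j) => [<-|ij]; last first.
    by rewrite mulrA cxy // -!mulrA -mulrBr; apply: Pl.
  have -> : x i * (y i * v) - y i * v * x i = y i * (x i * v - v * x i) - e i * v.
    rewrite /e mulrBl mul1r mulrBr !mulrA yx mul1r opprB [RHS]addrC.
    by rewrite addrA subrK.
  by apply: PB; [apply: Pl|apply: Pr].
- by rewrite -scalerAl -scalerAr -scalerBr; apply: idealZ.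
- by rewrite mulrDl mulrDr opprD addrACA; apply: idealD.
Qed.

Lemma polx_central (P : A -> Prop) (S : {set 'I_n}) d u : is_ideal P ->
  (forall i, i \in S -> P (e i)) -> polx S d u -> central_mod P u.
Proof.
move=> idP Pe; elim=> {d u} [d|d i u iS _ IH|d k u _ IH|d u v _ IHu _ IHv].
- exact: central_mod1.
- by apply: central_modM => //; apply: x_central => //; apply: Pe.
- by move=> v; rewrite -scalerAl -scalerAr -scalerBr; apply: idealZ.
- exact: central_modD.
Qed.

(* The factor [m] is a monomial clearing the negative powers of the [x_i], since [y_i]
   is inverse to [x_i] modulo [P]. *)
Lemma gen_to_polx (P : A -> Prop) (C : {set 'I_n}) w : is_ideal P ->
  (forall i, i \in C -> P (e i)) -> gen C w ->
  exists d f m, [/\ polx C d f, polx C d m, forall v, P (v * m) -> P v &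
                    P (w * m - f)].
Proof.
move=> idP Pe; have [P0 PB Pl Pr] := idP.
elim=> {w} [|i w iC _ [d [f [m [pf pm cm h]]]]|i w iC _ [d [f [m [pf pm cm h]]]]
  |k w _ [d [f [m [pf pm cm h]]]]
  |w w' _ [d [f [m [pf pm cm h]]]] _ [d' [f' [m' [pf' pm' cm' h']]]]].
- exists 0%N, 1, 1; split=> [||v|]; rewrite ?mulr1 ?subrr //; exact: polx1.
- exists d.+1, (x i * f), m; split=> //; first exact: polxX.
    by apply: polx_le pm.
  by rewrite -mulrA -mulrBr; apply: Pl.
- exists d.+1, f, (m * x i); split=> [||v Pv|].
  + by apply: polx_le pf.
  + by rewrite -addn1; apply: polxM => //; apply: polx_x.
  (* Writing [1 = x_i y_i + e_i] shows that right multiplication by [x_i] can be cancelled modulo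
     [P]. *)
  + apply: cm; have -> : v * m = v * (m * x i) * y i + v * m * e i.
      by rewrite /e mulrBr mulr1 !mulrA addrC subrK.
    by apply: idealD => //; [apply: Pr|apply/Pl/Pe].
  + have -> : y i * w * (m * x i) - f = y i * (w * m - f) * x i.
      by rewrite mulrBr mulrBl !mulrA -(mulrA _ f) (polx_commx i pf) mulrA yx mul1r.
    by apply/Pr/Pl.
- exists d, (k *: f), m; split=> //; first exact: polxZ.
  by rewrite -scalerAl -scalerBr; apply: idealZ.
- exists (d + d')%N, (f * m' + f' * m), (m * m'); split.
  + by apply: polxD; [apply: polxM|rewrite addnC; apply: polxM].
  + exact: polxM.
  + by move=> v; rewrite mulrA => /cm'/cm.
  + have -> : (w + w') * (m * m') - (f * m' + f' * m) =
              (w * m - f) * m' + (w' * m' - f') * m.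
      rewrite mulrDl opprD addrACA !mulrBl !mulrA; congr (_ + (_ - _)).
      by rewrite -!mulrA (polx_comm pm pm').
    by apply: idealD => //; apply: Pr.
Qed.

(** An element of [Q] outside [P] is moved into the subalgebra of the [x_i, y_i] with [e_i] in [P],
    then multiplied by [m] to become a polynomial modulo [P]; as [m] can be cancelled, the result
    stays outside [P]. *)
Lemma central_step (P Q : A -> Prop) :
  is_prime_ideal P -> is_prime_ideal Q -> strict_subset P Q ->
  (forall i, P (e i) <-> Q (e i)) ->
  exists d f, [/\ polx setT d f, central_mod P f, Q f & ~ P f].
Proof.
move=> prP prQ [PQ [u [Qu Pu]]] PQe.
have [idP _ _] := prP; have [[_ QB _ Qr] _ _] := prQ.
pose C := [set i | `[< P (e i) >]].
have CP i : i \in C -> P (e i) by rewrite inE => /asboolP.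
have [i|w [gw Qw Pw]] := prime_reduce rel genA (C := C) prP prQ _ Qu Pu.
  by rewrite inE => /asboolP Pe; rewrite -PQe.
have [d [f [m [pf pm cm h]]]] := gen_to_polx idP CP gw.
exists d, f; split.
- by apply: polx_le pf; rewrite ?subsetT.
- exact: polx_central pf.
- by rewrite -[f](subKr (w * m)); apply: QB; [apply: Qr|apply: PQ].
- move=> Pf; apply/Pw/cm; rewrite -[w * m](subrK f); exact: idealD.
Qed.

Lemma mul_x_monomial (f : 'I_n -> nat) i (s : seq 'I_n) : uniq s -> i \in s ->
  x i * \prod_(j <- s) x j ^+ f j = \prod_(j <- s) x j ^+ (f j + (j == i)).
Proof.
elim: s => // j s IH /= /andP[js us]; rewrite !big_cons inE.
case: (eqVneq i j) js => [<- js _|ij _ /= si].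
  rewrite addn1 exprS -mulrA; congr (_ * (_ * _)).
  rewrite !big_seq; apply: eq_bigr => k ks; case: eqVneq => [ki|]; rewrite ?addn0 //.
  by move: js; rewrite -ki ks.
by rewrite mulrA (commrX _ (cxx i j)) -mulrA IH // addn0.
Qed.

(** Each exponent is bounded separately, which makes the index set a finite function type that is
    easy to count. *)
Definition monomial D (t : {ffun 'I_n -> 'I_D.+1}) : A := \prod_j x j ^+ t j.

Lemma polx_span d u : polx setT d u ->
  exists c : {ffun 'I_n -> 'I_d.+1} -> K, u = \sum_t c t *: monomial t.
Proof.
pose spn D v := exists c : {ffun 'I_n -> 'I_D.+1} -> K, v = \sum_t c t *: monomial t.
have spn0 D : spn D 0 by exists (fun _ => 0); rewrite big1 // => t _; rewrite scale0r.
have spnD D v w : spn D v -> spn D w -> spn D (v + w).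
  move=> [c ->] [c' ->]; exists (fun t => c t + c' t); rewrite -big_split.
  by apply: eq_bigr => t _; rewrite scalerDl.
have spnZ D k v : spn D v -> spn D (k *: v).
  move=> [c ->]; exists (fun t => k * c t); rewrite scaler_sumr.
  by apply: eq_bigr => t _; rewrite scalerA.
have spnm D (f : 'I_n -> nat) : (forall i, f i <= D)%N -> spn D (\prod_j x j ^+ f j).
  move=> fD; pose t0 : {ffun 'I_n -> 'I_D.+1} := [ffun j => inord (f j)].
  exists (fun t => (t == t0)%:R); rewrite (bigD1 t0) //= eqxx scale1r.
  rewrite [X in _ = _ + X]big1 => [|t /negPf ->]; last by rewrite scale0r.
  by rewrite addr0; apply: eq_bigr => j _; rewrite ffunE inordK ?ltnS.
elim=> {d u} [d|d i u _ _ [c ->]|d k u _|d u v _ IHu _ IHv].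
- have -> : 1 = \prod_(j < n) x j ^+ 0 by rewrite big1.
  exact: spnm.
- rewrite mulr_sumr; apply: (big_ind (spn d.+1)) => [|v w|t _];
    [exact: spn0|exact: spnD|].
  rewrite -scalerAr; apply: spnZ.
  rewrite mul_x_monomial ?index_enum_uniq ?mem_index_enum //.
  apply: spnm => j; have := ltn_ord (t j); rewrite ltnS => h.
  by apply: leq_trans (leq_add h (leq_b1 _)) _; rewrite addn1.
- exact: spnZ.
- exact: spnD.
Qed.

(** The coefficient matrix has more rows than columns, so a nonzero row vector kills it from the
    left. *)
Lemma linear_dependence (J T : finType) (v : J -> A) (M : J -> T -> K) (w : T -> A) :
  (forall j, v j = \sum_t M j t *: w t) -> (#|T| < #|J|)%N ->
  exists c : J -> K, (exists j, c j != 0) /\ \sum_j c j *: v j = 0.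
Proof.
move=> vE TJ.
pose B : 'M[K]_(#|J|, #|T|) := \matrix_(j, t) M (enum_val j) (enum_val t).
have : kermx B != 0.
  rewrite kermx_eq0; apply: contraTN TJ => /eqP <-; rewrite -leqNgt; exact: rank_leq_col.
move=> /rowV0Pn[u /sub_kermxP uB u0].
exists (fun j => u 0 (enum_rank j)); split.
  have [j uj] := rV0Pn _ u0; exists (enum_val j); by rewrite enum_valK.
under eq_bigr do rewrite vE scaler_sumr.
rewrite exchange_big big1 // => t _.
under eq_bigr do rewrite scalerA.
rewrite -scaler_suml (reindex (enum_val : 'I_#|J| -> J)) /=;
  last exact: onW_bij (enum_val_bij _).
suff -> : \sum_(j < #|J|) u 0 (enum_rank (enum_val j)) * M (enum_val j) t = 0.
  by rewrite scale0r.
have := uB => /rowP/(_ (enum_rank t)); rewrite !mxE => uBt; rewrite -[RHS]uBt.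
by apply: eq_bigr => j _; rewrite enum_valK mxE enum_rankK.
Qed.

End Polynomials.

(** * Upper bound *)

(** Modulo [Q], which contains [a], only the term of exponent [0] survives, so its coefficient is
    zero; then a factor [a], regular modulo [P], is cancelled and the argument repeats. *)
Lemma power_coefs (R : nzRingType) (P Q : R -> Prop) (a : R) N (w : 'I_N -> R) :
  is_prime_ideal P -> is_ideal Q -> (forall u, P u -> Q u) ->
  central_mod P a -> ~ P a -> Q a -> P (\sum_(i < N) a ^+ i * w i) ->
  (forall i, Q (w i) -> w i = 0) -> forall i, w i = 0.
Proof.
move=> prP idQ PQ ca nPa Qa; have [_ QB _ Qr] := idQ.
elim: N w => [|N IH] w Pw Q0 i; first by case: i.
have eS : \sum_(i < N.+1) a ^+ i * w i
    = w ord0 + a * \sum_(i < N) a ^+ i * w (lift ord0 i).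
  rewrite big_ord_recl expr0 mul1r mulr_sumr; congr (_ + _).
  by apply: eq_bigr => j _; rewrite lift0 exprS mulrA.
have w0 : w ord0 = 0.
  apply: Q0; rewrite -[w ord0](addrK (a * \sum_(i < N) a ^+ i * w (lift ord0 i))).
  by rewrite -eS; apply: QB; [apply: PQ|apply: Qr].
case: (unliftP ord0 i) => [j|] -> //; apply: (IH (fun j => w (lift ord0 j))) => [|k].
  by apply: (prime_central prP ca nPa); move: Pw; rewrite eS w0 add0r.
exact: Q0.
Qed.

(** * Algebraic independence along a chain of primes *)

Section Independence.
Variables (K : fieldType) (A : algType K) (s : nat) (P : nat -> A -> Prop).
Variables (a : nat -> A) (N : nat).
Hypothesis prP : forall k, (k <= s)%N -> is_prime_ideal (P k).
Hypothesis PS : forall k, (k < s)%N -> forall u, P k u -> P k.+1 u.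

Lemma chain_le k l u : (k <= l <= s)%N -> P k u -> P l u.
Proof.
case/andP; elim: l => [|l IH]; first by rewrite leqn0 => /eqP ->.
rewrite leq_eqVlt => /orP[/eqP-> //|kl ls Pu].
by apply: PS => //; apply: IH => //; apply: ltnW.
Qed.

(** Exponent vectors are nested pairs, so that a product can be split at its first factor. *)
Fixpoint expos m : finType := if m is m'.+1 then ('I_N * expos m')%type else unit.

Lemma card_expos m : #|expos m| = (N ^ m)%N.
Proof. by elim: m => [|m IH] /=; rewrite ?card_unit // card_prod card_ord IH expnS. Qed.

Fixpoint power_prod (ks : seq nat) : expos (size ks) -> A :=
  if ks is k :: ks' then fun j => a k ^+ j.1 * power_prod j.2 else fun=> 1.

Definition transverse k :=
  [/\ (k < s)%N, central_mod (P k) (a k), P k.+1 (a k) & ~ P k (a k)].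

(* A relation among the products of powers of the [a k] is reduced modulo the
   [P k] in increasing order of [k]: modulo [P k] the smallest occurring power
   of [a k] cancels, and modulo [P k.+1] the higher powers vanish. *)
Lemma power_prod_indep ks l (c : expos (size ks) -> K) :
  (l <= s)%N -> sorted ltn ks -> (forall k, k \in ks -> (l <= k)%N /\ transverse k) ->
  P l (\sum_j c j *: power_prod j) -> forall j, c j = 0.
Proof.
elim: ks l c => [|k ks IH] l c ls sks tr.
  rewrite (big_pred1 tt) => [Pc|]; last by case.
  case=> /=; apply: contrapT => c0; have [idP P1 _] := prP ls; apply: P1.
  rewrite -[1](scalerK (a := c tt)); last exact/eqP.
  exact: idealZ.
have [lk [ks_ ca Sa na]] := tr k (mem_head _ _); move: ks_ => ks'.
have prk := prP (ltnW ks'); have [idS _ _] := prP ks'.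
(* Group the relation by the exponent [i] of the smallest step [k]; its coefficient is [w i]
   below. *)
have -> : \sum_j c j *: power_prod j =
    \sum_(i < N) \sum_(j : expos (size ks)) c (i, j) *: (a k ^+ i * power_prod j).
  by rewrite pair_bigA; apply: eq_bigr => -[].
pose w i := \sum_j c (i, j) *: power_prod j.
move=> Pl; have Pw : P k (\sum_(i < N) a k ^+ i * w i).
  apply: (@chain_le l); first by rewrite lk ltnW.
  congr (P l _) : Pl; apply: eq_bigr => i _; rewrite mulr_sumr.
  by apply: eq_bigr => j _; rewrite scalerAr.
(* The remaining steps exceed [k], so the induction hypothesis applies modulo [P k.+1]. *)
have c0 i : P k.+1 (w i) -> forall j, c (i, j) = 0.
  apply: (IH k.+1 (fun j => c (i, j)) ks' (path_sorted sks)) => k' k'ks.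
  have [|_ t] := tr k'; first by rewrite inE k'ks orbT.
  by split=> //; have /allP/(_ _ k'ks) := order_path_min ltn_trans sks.
have c0w i : P k.+1 (w i) -> w i = 0.
  by move=> h; rewrite /w big1 // => j _; rewrite (c0 i h) scale0r.
have w0 := power_coefs prk idS (PS ks') ca na Sa Pw c0w.
by case=> i j; apply: c0; rewrite w0; case: idS.
Qed.

End Independence.

Section UpperBound.
Variables (K : fieldType) (n : nat) (A : algType K) (x y : 'I_n -> A).
Hypothesis rel : jacobson_relations x y.
Hypothesis genA : forall a, gen x y setT a.

Lemma polx_power_prod a N ks d : (forall k, k \in ks -> polx x setT d (a k)) ->
  forall j : expos N (size ks), polx x setT (size ks * (N * d)) (power_prod a j).
Proof.
elim: ks => [|k ks IH] h /=; first by move=> _; apply: polx1.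
case=> i j /=; rewrite mulSn; apply: polxM.
  apply: (@polx_le _ _ _ _ setT _ (i * d)) => //.
    by rewrite leq_mul2r ltnW ?orbT.
  by apply/polx_pow/h/mem_head.
by apply: IH => k' h'; apply: h; rewrite inE h' orbT.
Qed.

(** With [m] the length of the list, [N^m] products lie in the span of [(m N d + 1)^n] monomials; as
    [m > n], the first number wins for large [N]. *)
Lemma polx_dependence a ks d : (n < size ks)%N ->
  (forall k, k \in ks -> polx x setT d (a k)) ->
  exists N (c : expos N (size ks) -> K),
    (exists j, c j != 0) /\ \sum_j c j *: power_prod a j = 0.
Proof.
move=> nks h; set m := size ks.
(* For this [N] one has [(m N d + 1)^n <= N^n (m d + 1)^n < N^(n+1) <= N^m]. *)
pose N := (((m * d).+1 ^ n).+1)%N; exists N.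
pose D := (m * (N * d))%N.
have sp j := polx_span rel (polx_power_prod (N := N) h j).
have [M hM] := choice sp.
apply: (linear_dependence (T := {ffun 'I_n -> 'I_D.+1}) hM).
rewrite card_expos card_ffun !card_ord.
apply: (@leq_trans (N ^ n.+1)); last by rewrite leq_exp2l // ltnS expn_gt0.
apply: (@leq_ltn_trans ((N * (m * d).+1) ^ n)).
  have [->|n0] := posnP n; first by rewrite !expn0.
  by rewrite leq_exp2r // /D mulnCA mulnS -add1n leq_add2r.
by rewrite expnMn expnSr ltn_mul2l expn_gt0 ltnSn.
Qed.

Lemma prime_chain_bound s : has_prime_chain A s -> (s <= 2 * n)%N.
Proof.
move=> [P [prP sub]].
have PS k : (k < s)%N -> forall u, P k u -> P k.+1 u by move=> /sub[].
pose C k := [set i : 'I_n | `[< P k (e x y i) >]].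
have CS k : (k < s)%N -> C k \subset C k.+1.
  move=> ks; apply/subsetP=> i; rewrite !inE => /asboolP h; apply/asboolP.
  exact: PS.
(* Each step that changes [C] adds at least one index. *)
have cnt t : (t <= s)%N -> (count (fun k => C k != C k.+1) (iota 0 t) <= #|C t|)%N.
  elim: t => [|t IH] // ts; rewrite -addn1 iotaD count_cat /= add0n addn0 addn1.
  apply: leq_trans (leq_add (IH (ltnW ts)) (leqnn _)) _.
  case: eqVneq => [->|ne]; first by rewrite addn0.
  by rewrite addn1; apply: proper_card; rewrite properEneq ne CS.
pose ks := [seq k <- iota 0 s | C k == C k.+1].
have sz : (s <= size ks + n)%N.
  rewrite size_filter -{1}(size_iota 0 s) -(count_predC (fun k => C k == C k.+1)).
  rewrite leq_add2l; apply: leq_trans (cnt s (leqnn _)) _.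
  by rewrite -[X in (_ <= X)%N]card_ord max_card.
rewrite leqNgt; apply/negP => sn.
have nks : (n < size ks)%N.
  by rewrite -(ltn_add2r n); apply: leq_trans sz; rewrite addnn -mul2n.
(* Outside [ks] the pair [(0, 0)] is a dummy value, so that choice yields a function on all of
   [nat]. *)
have step k : exists df : nat * A, k \in ks ->
    [/\ polx x setT df.1 df.2, central_mod (P k) df.2, P k.+1 df.2 & ~ P k df.2].
  case: (boolP (k \in ks)) => [|_]; last by exists (0%N, 0).
  rewrite mem_filter mem_iota /= add0n => /andP[/eqP Ck ks'].
  have [i|d [f h]] := central_step rel genA (prP _ (ltnW ks')) (prP _ ks') (sub _ ks').
    have := congr1 (fun S : {set _} => i \in S) Ck; rewrite !inE => h.
    by split=> /asboolP; [rewrite h|rewrite -h] => /asboolP.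
  by exists (d, f).
have [F hF] := choice step.
pose d := \max_(k <- ks) (F k).1.
have [k kks|N [c [[j cj] c0]]] := @polx_dependence (fun k => (F k).2) ks d nks.
  have [pF _ _ _] := hF k kks; apply: polx_le pF => //.
  exact: (@leq_bigmax_seq _ ks xpredT (fun k => (F k).1) k).
case/eqP: cj; apply: (power_prod_indep (a := fun k => (F k).2) prP PS (leq0n s) _ _ _ j).
- by apply: sorted_filter; [apply: ltn_trans|apply: iota_ltn_sorted].
- move=> k kks; have [_ h1 h2 h3] := hF k kks.
  by split=> //; split=> //; move: kks; rewrite mem_filter mem_iota add0n => /and3P[].
- by rewrite c0; have [[]] := prP 0 (leq0n s).
Qed.

End UpperBound.

(** * Shift operators on K(t)-valued functions of multi-indices *)

Section Operators.
Variables (K : fieldType) (n : nat).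

Definition multi := {ffun 'I_n -> nat}.
Definition vect := multi -> {fraction {poly K}}.

Definition linear_op (f : vect -> vect) := forall k (g h : vect),
  f (fun a => k * g a + h a) = fun a => k * f g a + f h a.

(** Bundled [K(t)]-linear maps; they are made into a [K]-algebra, to which the universal property of
    [A] can be applied. *)
Record op := Op { op_fun :> vect -> vect; op_linear : linear_op op_fun }.

Lemma opP (f g : op) : (forall v a, f v a = g v a) -> f = g.
Proof.
case: f g => f lf [g lg] /= fg; have fgE : f = g by apply/funext=> v; apply/funext.
by case: _ / fgE lg => lg; congr Op; apply: Prop_irrelevance.
Qed.

Lemma opD (f : op) g h : f (fun a => g a + h a) = fun a => f g a + f h a.
Proof.
rewrite -[LHS](congr1 f (_ : (fun a => 1 * g a + h a) = _)); last first.
  by apply/funext=> a; rewrite mul1r.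
by rewrite op_linear; apply/funext=> a; rewrite mul1r.
Qed.

Lemma op0 (f : op) : f (fun=> 0) = fun=> 0.
Proof.
apply/funext=> a; apply: (addrI (f (fun=> 0) a)); rewrite addr0.
by rewrite -[LHS](congr1 (fun h => h a) (opD f _ _)); congr (f _ a);
  apply/funext=> b; rewrite addr0.
Qed.

Lemma opZ (f : op) k g : f (fun a => k * g a) = fun a => k * f g a.
Proof.
rewrite -[LHS](congr1 f (_ : (fun a => k * g a + 0) = _)); last first.
  by apply/funext=> a; rewrite addr0.
by rewrite op_linear op0; apply/funext=> a; rewrite addr0.
Qed.

HB.instance Definition _ := gen_eqMixin op.
HB.instance Definition _ := gen_choiceMixin op.

Lemma zero_op_linear : linear_op (fun _ _ => 0).
Proof. by move=> k g h; apply/funext=> a; rewrite mulr0 addr0. Qed.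
Lemma add_op_linear (f g : op) : linear_op (fun v a => f v a + g v a).
Proof. by move=> k u v; apply/funext=> a; rewrite !op_linear mulrDr addrACA. Qed.
Lemma opp_op_linear (f : op) : linear_op (fun v a => - f v a).
Proof. by move=> k u v; apply/funext=> a; rewrite !op_linear opprD mulrN. Qed.
Lemma one_op_linear : linear_op id.
Proof. by []. Qed.
Lemma mul_op_linear (f g : op) : linear_op (fun v => f (g v)).
Proof. by move=> k u v; rewrite !op_linear. Qed.
Lemma scale_op_linear (c : K) (f : op) :
  linear_op (fun v a => FracField.tofrac c%:P * f v a).
Proof. by move=> k u v; apply/funext=> a; rewrite op_linear mulrDr mulrCA. Qed.

Definition zero_op := Op zero_op_linear.
Definition add_op f g := Op (add_op_linear f g).
Definition opp_op f := Op (opp_op_linear f).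
Definition one_op := Op one_op_linear.
Definition mul_op f g := Op (mul_op_linear f g).
Definition scale_op c f := Op (scale_op_linear c f).

Lemma add_opA : associative add_op.
Proof. by move=> f g h; apply: opP => v a /=; rewrite addrA. Qed.
Lemma add_opC : commutative add_op.
Proof. by move=> f g; apply: opP => v a /=; rewrite addrC. Qed.
Lemma add_0op : left_id zero_op add_op.
Proof. by move=> f; apply: opP => v a /=; rewrite add0r. Qed.
Lemma add_opN : left_inverse zero_op opp_op add_op.
Proof. by move=> f; apply: opP => v a /=; rewrite addNr. Qed.
HB.instance Definition _ := GRing.isZmodule.Build op add_opA add_opC add_0op add_opN.

Lemma mul_opA : associative mul_op.
Proof. by move=> f g h; apply: opP. Qed.
Lemma mul_1op : left_id one_op mul_op.
Proof. by move=> f; apply: opP. Qed.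
Lemma mul_op1 : right_id one_op mul_op.
Proof. by move=> f; apply: opP. Qed.
Lemma mul_opDl : left_distributive mul_op +%R.
Proof. by move=> f g h; apply: opP. Qed.
Lemma mul_opDr : right_distributive mul_op +%R.
Proof. by move=> f g h; apply: opP => v a /=; rewrite opD. Qed.
Lemma one_op_neq0 : one_op != 0.
Proof.
apply/eqP => /(congr1 (fun f : op => f (fun=> 1) [ffun=> 0%N])) /= /eqP.
by rewrite oner_eq0.
Qed.
HB.instance Definition _ := GRing.Zmodule_isNzRing.Build op
  mul_opA mul_1op mul_op1 mul_opDl mul_opDr one_op_neq0.

Lemma scale_opA c d f : scale_op c (scale_op d f) = scale_op (c * d) f.
Proof. by apply: opP => v a /=; rewrite mulrA polyCM tofracM. Qed.
Lemma scale_1op : left_id 1 scale_op.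
Proof. by move=> f; apply: opP => v a /=; rewrite tofrac1 mul1r. Qed.
Lemma scale_opDr : right_distributive scale_op +%R.
Proof. by move=> c f g; apply: opP => v a /=; rewrite mulrDr. Qed.
Lemma scale_opDl f : {morph scale_op^~ f : c d / c + d}.
Proof. by move=> c d; apply: opP => v a /=; rewrite polyCD tofracD mulrDl. Qed.
HB.instance Definition _ := GRing.Zmodule_isLmodule.Build K op
  scale_opA scale_1op scale_opDr scale_opDl.

Lemma scale_opAl c (f g : op) : c *: (f * g) = (c *: f) * g.
Proof. exact: opP. Qed.
HB.instance Definition _ := GRing.Lmodule_isLalgebra.Build K op scale_opAl.
Lemma scale_opAr c (f g : op) : c *: (f * g) = f * (c *: g).
Proof. by apply: opP => v a /=; rewrite opZ. Qed.
HB.instance Definition _ := GRing.Lalgebra_isAlgebra.Build K op scale_opAr.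

Lemma add_opE (f g : op) v a : (f + g) v a = f v a + g v a. Proof. by []. Qed.
Lemma sub_opE (f g : op) v a : (f - g) v a = f v a - g v a. Proof. by []. Qed.
Lemma mul_opE (f g : op) v : (f * g) v = f (g v). Proof. by []. Qed.
Lemma one_opE v : (1 : op) v = v. Proof. by []. Qed.
Lemma scale_opE c (f : op) v a : (c *: f) v a = FracField.tofrac c%:P * f v a.
Proof. by []. Qed.

End Operators.

Section MultiIndices.
Variable n : nat.

Implicit Types a b : multi n.

Definition multi0 : multi n := [ffun=> 0%N].
Definition inc i a : multi n := [ffun j => (a j + (j == i))%N].
(** The subtraction is truncated: a zero coordinate stays zero, hence the tests for zero in [decK]
    and [shiftX]. *)
Definition dec i a : multi n := [ffun j => (a j - (j == i))%N].

Lemma incK i : cancel (inc i) (dec i).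
Proof. by move=> a; apply/ffunP=> j; rewrite !ffunE addnK. Qed.

Lemma decK i a : a i != 0%N -> inc i (dec i a) = a.
Proof.
move=> ai; apply/ffunP=> j; rewrite !ffunE subnK //.
by case: eqVneq => [->|//]; rewrite lt0n.
Qed.

Lemma inc_inc i j a : inc i (inc j a) = inc j (inc i a).
Proof. by apply/ffunP=> k; rewrite !ffunE addnAC. Qed.

Lemma dec_dec i j a : dec i (dec j a) = dec j (dec i a).
Proof. by apply/ffunP=> k; rewrite !ffunE subnAC. Qed.

Lemma dec_inc i j a : i != j -> dec i (inc j a) = inc j (dec i a).
Proof.
move=> ij; apply/ffunP=> k; rewrite !ffunE; case: (eqVneq k j) => [->|_].
  by rewrite eq_sym (negPf ij) !subn0.
by rewrite !addn0.
Qed.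

Lemma inc_ii i a : inc i a i != 0%N.
Proof. by rewrite ffunE eqxx addn1. Qed.

Lemma inc_ij i j a : i != j -> inc i a j = a j.
Proof. by move=> ij; rewrite ffunE eq_sym (negPf ij) addn0. Qed.

Lemma dec_ij i j a : i != j -> dec i a j = a j.
Proof. by move=> ij; rewrite ffunE eq_sym (negPf ij) subn0. Qed.

Lemma multi_ind (Q : multi n -> Prop) :
  Q multi0 -> (forall i a, Q a -> Q (inc i a)) -> forall a, Q a.
Proof.
move=> Q0 QS a; have [m] := ubnP (\sum_i a i); elim: m a => // m IH a am.
case: (eqVneq a multi0) => [-> //|a0].
have [i ai] : exists i, a i != 0%N.
  apply/existsP; apply: contraNT a0; rewrite negb_exists => /forallP h.
  by apply/eqP/ffunP=> i; rewrite ffunE; apply/eqP; have := h i; rewrite negbK.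
rewrite -(decK ai); apply/QS/IH; rewrite -ltnS; apply: leq_trans am.
rewrite ltnS (bigD1 i) //= [X in (_ < X)%N](bigD1 i) //= -addSn leq_add //.
  by rewrite ffunE eqxx subn1 prednK // lt0n.
by apply: leq_sum => j ji; rewrite dec_ij // eq_sym.
Qed.

End MultiIndices.

(** * Modules over the algebra and their annihilators *)

Section Model.
Variables (K : fieldType) (n : nat).
Local Notation E := {fraction {poly K}}.
Local Notation vect := (vect K n).
Local Notation op := (op K n).
Variables (C : {set 'I_n}) (lam : 'I_n -> E).
Implicit Types (a b c : multi n) (g : vect).
Hypothesis lam0 : forall i, lam i != 0.

(** For [i] outside [C] this raises the [i]-th coordinate of a delta function, while [shiftY] lowers
    it and kills the delta functions whose [i]-th coordinate is zero. *)
Definition shiftX i (g : vect) : vect := fun a =>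
  if i \in C then lam i * g a else if a i == 0%N then 0 else g (dec i a).
Definition shiftY i (g : vect) : vect := fun a =>
  if i \in C then (lam i)^-1 * g a else g (inc i a).

Lemma shiftX_linear i : linear_op (shiftX i).
Proof.
move=> k g h; apply/funext=> a; rewrite /shiftX.
case: ifP => _; first by rewrite mulrDr mulrCA.
by case: ifP => // _; rewrite mulr0 addr0.
Qed.
Lemma shiftY_linear i : linear_op (shiftY i).
Proof.
move=> k g h; apply/funext=> a; rewrite /shiftY.
by case: ifP => // _; rewrite mulrDr mulrCA.
Qed.
Definition opX i : op := Op (shiftX_linear i).
Definition opY i : op := Op (shiftY_linear i).

Lemma opXE i g a : opX i g a =
  if i \in C then lam i * g a else if a i == 0%N then 0 else g (dec i a).
Proof. by []. Qed.
Lemma opYE i g a : opY i g a =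
  if i \in C then (lam i)^-1 * g a else g (inc i a).
Proof. by []. Qed.

Lemma op_relations : jacobson_relations opX opY.
Proof.
split=> [i|i j ij].
  apply: opP => g a /=; rewrite /shiftX /shiftY.
  case: (i \in C); first by rewrite mulKf.
  by rewrite (negPf (inc_ii _ _)) incK.
have ji : j != i by rewrite eq_sym.
split; apply: opP => g a /=; rewrite /shiftX /shiftY;
  case: (i \in C); case: (j \in C) => //=;
  rewrite ?(dec_ij a ij) ?(dec_ij a ji) ?(inc_ij a ji) ?(inc_ij a ij).
- by rewrite mulrCA.
- by case: ifP; rewrite ?mulr0.
- by rewrite dec_inc.
- by rewrite mulrCA.
- by case: ifP; rewrite ?mulr0.
- by case: ifP; rewrite ?mulr0.
- by rewrite dec_dec; do 2?case: ifP.
- by rewrite mulrCA.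
- by rewrite inc_inc.
Qed.

Definition delta (b : multi n) : vect := fun a => (a == b)%:R.

Lemma opX_delta i b : i \notin C -> opX i (delta b) = delta (inc i b).
Proof.
move=> iC; apply/funext=> a; rewrite /= /shiftX (negPf iC) /delta.
case: (altP (a i =P 0%N)) => ai; last first.
  by rewrite -(inj_eq (can_inj (incK i))) decK.
by case: eqP => // ab; have := inc_ii i b; rewrite -ab ai.
Qed.

Lemma opY_delta i b : i \notin C ->
  opY i (delta b) = if b i == 0%N then fun=> 0 else delta (dec i b).
Proof.
move=> iC; apply/funext=> a; rewrite /= /shiftY (negPf iC) /delta.
case: (altP (b i =P 0%N)) => bi.
  by case: eqP => // ab; have := inc_ii i a; rewrite ab bi.
by rewrite -(inj_eq (can_inj (incK i)) a) decK.
Qed.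

Lemma opX_scalar i g : i \in C -> opX i g = fun a => lam i * g a.
Proof. by move=> iC; apply/funext=> a; rewrite /= /shiftX iC. Qed.

Lemma opY_scalar i g : i \in C -> opY i g = fun a => (lam i)^-1 * g a.
Proof. by move=> iC; apply/funext=> a; rewrite /= /shiftY iC. Qed.

Lemma opE g a i : (1 - opX i * opY i) g a =
  if (i \notin C) && (a i == 0%N) then g a else 0.
Proof.
rewrite sub_opE one_opE mul_opE opXE !opYE.
case: (i \in C); first by rewrite mulVKf // subrr.
by case: eqP => [_|/eqP ai]; rewrite ?subr0 // decK // subrr.
Qed.

(* The coordinates in [C] are inert, so only indices vanishing there are considered. *)
Definition supp (a : multi n) := [forall i, (i \in C) ==> (a i == 0%N)].

Lemma suppP a : reflect (forall i, i \in C -> a i = 0%N) (supp a).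
Proof.
by apply: (iffP forallP) => h i; [move/(implyP (h i))/eqP|apply/implyP=> /h ->].
Qed.

Lemma supp0 : supp (multi0 n).
Proof. by apply/suppP=> i _; rewrite ffunE. Qed.

Lemma supp_inc i a : i \notin C -> supp (inc i a) = supp a.
Proof.
move=> iC; apply/suppP/suppP => h j jC; have := h j jC; rewrite inc_ij //;
  by apply: contraNneq iC => ->.
Qed.

Lemma supp_inc_in i a : supp (inc i a) -> i \notin C.
Proof. by move=> /suppP h; apply: contraNN (inc_ii i a) => /h ->. Qed.

Lemma supp_dec i a : i \notin C -> supp (dec i a) = supp a.
Proof.
move=> iC; apply/suppP/suppP => h j jC; have := h j jC; rewrite dec_ij //;
  by apply: contraNneq iC => ->.
Qed.

Definition supported (g : vect) := forall a, ~~ supp a -> g a = 0.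

Lemma supported_delta b : supp b -> supported (delta b).
Proof. by move=> sb a; rewrite /delta; case: eqP => [->|//]; rewrite sb. Qed.

Variables (A : algType K) (x y : 'I_n -> A) (phi : A -> op).
Hypothesis rel : jacobson_relations x y.
Hypothesis genA : forall u, gen x y setT u.
Hypothesis phi_hom : is_alg_hom phi.
Hypothesis phi_xy : forall i, phi (x i) = opX i /\ phi (y i) = opY i.

Let phiD u v : phi (u + v) = phi u + phi v. Proof. by case: phi_hom. Qed.
Let phiM u v : phi (u * v) = phi u * phi v. Proof. by case: phi_hom. Qed.
Let phi1 : phi 1 = 1. Proof. by case: phi_hom. Qed.
Let phiZ k u : phi (k *: u) = k *: phi u. Proof. by case: phi_hom. Qed.
Let phix i : phi (x i) = opX i. Proof. by case: (phi_xy i). Qed.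
Let phiy i : phi (y i) = opY i. Proof. by case: (phi_xy i). Qed.
Let phiB u v : phi (u - v) = phi u - phi v.
Proof. by rewrite -scaleN1r phiD phiZ scaleN1r. Qed.
Let phi0 : phi 0 = 0. Proof. by rewrite -(subrr 0) phiB subrr. Qed.

Lemma phi_e i : phi (e x y i) = 1 - opX i * opY i.
Proof. by rewrite /e phiB phi1 phiM phix phiy. Qed.

Lemma supported_phi r g : supported g -> supported (phi r g).
Proof.
elim: (genA r) g => {r} [|i r _ _ IH|i r _ _ IH|k r _ IH|r s _ IHr _ IHs] g sg a sa.
- by rewrite phi1 one_opE sg.
- rewrite phiM phix mul_opE opXE; have sr := IH g sg.
  case: ifP => iC; first by rewrite sr // mulr0.
  by case: ifP => // _; rewrite sr // supp_dec ?iC.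
- rewrite phiM phiy mul_opE opYE; have sr := IH g sg.
  case: ifP => iC; first by rewrite sr // mulr0.
  by rewrite sr // supp_inc ?iC.
- by rewrite phiZ scale_opE IH // mulr0.
- by rewrite phiD add_opE IHr // IHs // addr0.
Qed.

(** The annihilator of the [K(t)]-span of the [delta b] with [supp b], tested on this basis. *)
Definition vanishing (u : A) := forall b, supp b -> forall a, phi u (delta b) a = 0.

Lemma vanishing_scale u b k : supp b -> vanishing u ->
  phi u (fun a => k * delta b a) = fun=> 0.
Proof. by move=> sb zu; rewrite opZ; apply/funext=> a; rewrite zu ?mulr0. Qed.

Lemma vanishing_ideal : is_ideal vanishing.
Proof.
split=> [b sb a|u v zu zv b sb a|r u zu b sb a|r u].
- by rewrite phi0.
- by rewrite phiB sub_opE zu // zv // subrr.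
- rewrite phiM mul_opE.
  by have -> : phi u (delta b) = fun=> 0 by [apply/funext=> c; apply: zu]; rewrite op0.
(* Right multiplication: each generator sends a supported delta function to zero or to a scalar
   multiple of a supported delta function. *)
elim: (genA r) u => {r} [|i r _ _ IH|i r _ _ IH|k r _ IH|r s _ IHr _ IHs] u zu.
- by rewrite mulr1.
- rewrite mulrA; apply: IH => b sb a.
  rewrite phiM phix mul_opE.
  case: (boolP (i \in C)) => iC; first by rewrite opX_scalar // vanishing_scale.
  by rewrite opX_delta // zu // supp_inc.
- rewrite mulrA; apply: IH => b sb a.
  rewrite phiM phiy mul_opE.
  case: (boolP (i \in C)) => iC; first by rewrite opY_scalar // vanishing_scale.
  rewrite opY_delta //; case: eqP => _; first by rewrite op0.
  by rewrite zu // supp_dec.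
- rewrite -scalerAr => b sb a; rewrite phiZ scale_opE.
  by rewrite IH ?mulr0.
- rewrite mulrDr => b sb a; rewrite phiD add_opE.
  by rewrite IHr // IHs // addr0.
Qed.

Lemma move_to_multi0 b : supp b -> exists r, forall g, phi r g (multi0 n) = g b.
Proof.
elim/multi_ind: b => [|i b IH] sb; first by exists 1 => g; rewrite phi1.
have iC := supp_inc_in sb; rewrite supp_inc // in sb; have [r hr] := IH sb.
exists (r * y i) => g; rewrite phiM mul_opE hr phiy.
by rewrite opYE (negPf iC).
Qed.

Lemma create_delta b : supp b -> exists r, phi r (delta (multi0 n)) = delta b.
Proof.
elim/multi_ind: b => [|i b IH] sb; first by exists 1; rewrite phi1.
have iC := supp_inc_in sb; rewrite supp_inc // in sb; have [r hr] := IH sb.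
exists (x i * r); rewrite phiM mul_opE hr phix.
exact: opX_delta.
Qed.

(** The product of the [e i] with [i] outside [C] keeps the values at indices vanishing outside [C];
    for a supported function only the origin remains. *)
Lemma project_multi0 :
  exists r, forall g, supported g -> phi r g = fun a => g (multi0 n) * delta (multi0 n) a.
Proof.
have prodE s g a : {subset s <= ~: C} -> phi (\prod_(i <- s) e x y i) g a =
    if all (fun i => a i == 0%N) s then g a else 0.
  elim: s => [|i s IH] sC; first by rewrite big_nil phi1.
  rewrite big_cons phiM mul_opE phi_e opE.
  have := sC i (mem_head _ _); rewrite inE => -> /=.
  by rewrite IH => [|j js]; [case: eqP|apply: sC; rewrite inE js orbT].
exists (\prod_(i <- enum (~: C)) e x y i) => g sg; apply/funext=> a.
rewrite prodE => [|i]; last by rewrite mem_enum.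
rewrite /delta; case: allP => h.
  case: eqP => [->|a0]; first by rewrite mulr1.
  rewrite mulr0; apply: sg; apply/negP=> /suppP sa; apply: a0.
  apply/ffunP=> i; rewrite ffunE; case: (boolP (i \in C)) => iC; first exact: sa.
  by apply/eqP/h; rewrite mem_enum inE.
case: eqP => [a0|]; last by rewrite mulr0.
by case: h => i _; rewrite a0 ffunE.
Qed.

(** Move the value at [c] to the origin by the [y i], project there, and carry the origin to [b] by
    the [x i]. *)
Lemma matrix_unit b c : supp b -> supp c ->
  exists r, forall g, supported g -> phi r g = fun a => g c * delta b a.
Proof.
move=> sb sc; have [r1 h1] := move_to_multi0 sc; have [r2 h2] := create_delta sb.
have [r3 h3] := project_multi0; exists (r2 * (r3 * r1)) => g sg.
rewrite !phiM !mul_opE h3; last exact: supported_phi.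
by rewrite h1 opZ h2.
Qed.

Lemma not_vanishing u : ~ vanishing u -> exists b a, supp b /\ phi u (delta b) a != 0.
Proof.
move=> zu; apply: contrapT => h; apply: zu => b sb a; apply/eqP.
by apply: contrapT => /negP ua; apply: h; exists b, a.
Qed.

Lemma vanishing_prime : is_prime_ideal vanishing.
Proof.
split; first exact: vanishing_ideal.
  move=> /(_ _ supp0 (multi0 n)); rewrite phi1 one_opE /delta eqxx.
  exact/eqP/oner_neq0.
move=> I J idI [_ _ Jl _] IJ; apply: contrapT => /not_orP[/existsNP[u]].
move=> /not_implyP[Iu /not_vanishing[b [a [sb ua]]]] /existsNP[v].
move=> /not_implyP[Jv /not_vanishing[d [c [sd vc]]]].
have sv : supported (phi v (delta d)) by apply/supported_phi/supported_delta.
have sc : supp c by apply: contraNT vc => /sv ->.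
(* The matrix unit links a nonzero entry of [v] to one of [u], so an entry of [u r v] is a product
   of two nonzero elements of a field. *)
have [r hr] := matrix_unit sb sc.
have := IJ u (r * v) Iu (Jl _ _ Jv) d sd a.
rewrite !phiM !mul_opE hr // opZ => /eqP.
by rewrite mulf_eq0 (negPf ua) (negPf vc).
Qed.

Lemma vanishing_e i : vanishing (e x y i) <-> i \in C.
Proof.
split=> [/(_ _ supp0 (multi0 n))|iC b sb a]; rewrite phi_e opE ?iC //.
apply: contraPT => ->; rewrite ffunE /delta !eqxx; exact/eqP/oner_neq0.
Qed.

Lemma vanishing_x1 i : i \in C -> lam i = 1 -> vanishing (x i - 1).
Proof.
move=> iC l1 b sb a; rewrite phiB phi1 phix sub_opE one_opE.
by rewrite opX_scalar // l1 mul1r subrr.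
Qed.

Lemma horner_algE (p : {poly K}) (u : A) :
  horner_alg u p = \sum_(k < size p) p`_k *: u ^+ k.
Proof.
rewrite -{1}[p]coefK poly_def linear_sum; apply: eq_bigr => k _ /=.
by rewrite linearZ rmorphXn /= horner_algX mulr_algl.
Qed.

Lemma phi_horner (p : {poly K}) (u : A) g a : phi (horner_alg u p) g a =
  \sum_(k < size p) FracField.tofrac (p`_k)%:P * iter k (phi u) g a.
Proof.
rewrite horner_algE (big_morph phi phiD phi0).
rewrite (big_morph (fun f : op => f g a) (id1 := 0) (op1 := +%R)) //.
apply: eq_bigr => k _; rewrite phiZ scale_opE; congr (_ * _).
elim: (val k) g => [|m IH] g; first by rewrite expr0 phi1.
by rewrite exprSr phiM mul_opE IH iterSr.
Qed.

(** If [x_j] acts by [t], then [p] acts by [p(t)]; if [x_j] shifts, its powers send the delta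
    function of the origin to distinct delta functions, whose coefficients are those of [p]. *)
Lemma vanishing_horner j (p : {poly K}) :
  (j \in C -> lam j = FracField.tofrac 'X) -> vanishing (horner_alg (x j) p) -> p = 0.
Proof.
move=> lX zp; case: (boolP (j \in C)) => jC.
  have it k g a : iter k (opX j) g a = FracField.tofrac ('X ^+ k) * g a.
    elim: k => [|k IH] in a *; first by rewrite expr0 tofrac1 mul1r.
    by rewrite iterS opX_scalar // IH lX // exprS tofracM mulrA.
  have := zp _ supp0 (multi0 n); rewrite phi_horner phix.
  under eq_bigr do rewrite it /delta eqxx mulr1 -tofracM mul_polyC.
  rewrite -(big_morph _ (@tofracD _) (@tofrac0 _)) -poly_def coefK => /eqP.
  by rewrite tofrac_eq0 => /eqP.
have it k : iter k (opX j) (delta (multi0 n)) = delta (iter k (inc j) (multi0 n)).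
  by elim: k => //= k ->; apply: opX_delta.
have itj k : iter k (inc j) (multi0 n) j = k.
  by elim: k => [|k IH] /=; rewrite ffunE ?IH // eqxx addn1.
apply/polyP=> k; rewrite coef0; case: (ltnP k (size p)) => kp; last exact: nth_default.
have := zp _ supp0 (iter k (inc j) (multi0 n)); rewrite phi_horner phix.
rewrite (bigD1 (Ordinal kp)) //= it /delta eqxx mulr1 big1 => [|m mk].
  by rewrite addr0 => /eqP; rewrite tofrac_eq0 polyC_eq0 => /eqP.
rewrite it /delta; case: eqP => [/(congr1 (fun f : multi n => f j))|_];
  last by rewrite mulr0.
by rewrite !itj => km; case/eqP: mk; apply: val_inj.
Qed.

End Model.

(** * Lower bound *)

Section Inclusion.
Variables (K : fieldType) (n : nat) (A : algType K) (x y : 'I_n -> A).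
Hypothesis rel : jacobson_relations x y.
Hypothesis genA : forall a, gen x y setT a.

Local Notation gen := (gen x y).
Local Notation e := (e x y).

Let yx i : y i * x i = 1. Proof. by case: rel. Qed.

(** Modulo [x_i - 1] also [y_i = 1], because [y_i x_i = 1]. The scalar is chosen before the ideal,
    so that one scalar serves two primes at once. *)
Lemma gen_mod_scalar (D : {set 'I_n}) v : gen D v ->
  exists k : K, forall Q : A -> Prop, is_ideal Q ->
    (forall i, i \in D -> Q (x i - 1)) -> Q (v - k%:A).
Proof.
elim=> {v} [|i v iD _ [k hk]|i v iD _ [k hk]|c v _ [k hk]|u v _ [k hk] _ [l hl]].
- by exists 1 => Q [Q0 _ _ _] _; rewrite scale1r subrr.
- exists k => Q idQ Qx; have [_ _ _ Qr] := idQ.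
  rewrite -[_ - _](subrKA v) -{2}[v]mul1r -mulrBl; apply: idealD => //; last exact: hk.
  by apply/Qr/Qx.
- exists k => Q idQ Qx; have [Q0 QB Ql Qr] := idQ.
  rewrite -[_ - _](subrKA v) -{2}[v]mul1r -mulrBl; apply: idealD => //; last exact: hk.
  apply: Qr; have -> : y i - 1 = 0 - y i * (x i - 1).
    by rewrite mulrBr yx mulr1 sub0r opprB.
  by apply: QB => //; apply/Ql/Qx.
- exists (c * k) => Q idQ Qx; rewrite -scalerA -scalerBr.
  by apply: idealZ => //; apply: hk.
- exists (k + l) => Q idQ Qx; rewrite scalerDl opprD addrACA.
  by apply: idealD => //; [apply: hk|apply: hl].
Qed.

(** In the normal form for [j] the middle factors become scalars, and a power of [x_j] on the right
    absorbs the powers of [y_j]. Again [N] and [F] are chosen before [Q]. *)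
Lemma gen_mod_poly (C : {set 'I_n}) j w : gen C w ->
  exists N (F : {poly K}), forall Q : A -> Prop, is_ideal Q ->
    (forall i, i \in C :\ j -> Q (x i - 1)) ->
    Q (w * x j ^+ N - horner_alg (x j) F).
Proof.
apply: (@gen_nf_ind _ _ _ _ _ rel C j (fun w => exists N (F : {poly K}),
  forall Q : A -> Prop, is_ideal Q -> (forall i, i \in C :\ j -> Q (x i - 1)) ->
  Q (w * x j ^+ N - horner_alg (x j) F))) => [a v b gv|u v [N [F hF]] [M [G hG]]].
  have [k hk] := gen_mod_scalar gv.
  exists b, (k *: 'X^a) => Q idQ Qx; have [_ _ Ql _] := idQ.
  rewrite linearZ rmorphXn /= horner_algX -!mulrA (yXxX rel) mulr1.
  have -> : k%:A * x j ^+ a = x j ^+ a * k%:A by rewrite mulr_algl mulr_algr.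
  by rewrite -mulrBr; apply: Ql; apply: hk.
exists (N + M)%N, (F * 'X^M + G * 'X^N) => Q idQ Qx; have [_ _ _ Qr] := idQ.
rewrite rmorphD !rmorphM !rmorphXn /= !horner_algX mulrDl opprD addrACA.
rewrite {1}exprD addnC exprD !mulrA -!mulrBl.
by apply: idealD => //; apply: Qr; [apply: hF|apply: hG].
Qed.

(** Otherwise reduction gives [w] in [Q] and not in [P] with [w x_j^N] congruent to the same
    [F(x_j)] modulo both primes. Then [F = 0], so [w x_j^N] is in [P]; as [x_j] is right invertible
    modulo [P], so is [w], a contradiction. *)
Lemma prime_incl (P Q : A -> Prop) (C : {set 'I_n}) j :
  is_prime_ideal P -> is_prime_ideal Q ->
  (forall i, i \notin C -> ~ P (e i) /\ ~ Q (e i)) ->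
  (forall i, i \in C :\ j -> P (x i - 1) /\ Q (x i - 1)) ->
  P (e j) -> (forall F, Q (horner_alg (x j) F) -> F = 0) ->
  forall u, Q u -> P u.
Proof.
move=> prP prQ eC xC Pj Q0 u Qu; apply: contrapT => Pu.
have [idP _ _] := prP; have [idQ _ _] := prQ.
have [w [gw Qw Pw]] := prime_reduce rel genA prP prQ eC Qu Pu.
have [N [F hF]] := gen_mod_poly j gw.
have F0 : F = 0.
  apply: Q0; case: (idQ) => _ QB _ Qr.
  rewrite -[horner_alg _ _](subKr (w * x j ^+ N)).
  by apply: QB; [apply: Qr|apply: hF => // i /xC[]].
apply: Pw; have := hF P idP (fun i iC => proj1 (xC i iC)).
rewrite F0 rmorph0 subr0; elim: N {hF} => [|N IH]; first by rewrite mulr1.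
move=> h; apply: IH; have [_ _ Pl Pr] := idP.
have -> : w * x j ^+ N = w * x j ^+ N.+1 * y j + w * x j ^+ N * e j.
  by rewrite /e mulrBr mulr1 exprSr !mulrA addrC subrK.
by apply: idealD => //; [apply: Pr|apply: Pl].
Qed.

End Inclusion.

Section LowerBound.
Variables (K : fieldType) (n : nat) (A : algType K) (x y : 'I_n -> A).
Hypothesis SnA : is_S_n x y.

(** The index [i] changes twice: at [k = 2i + 1], where [e_i] enters and [x_i] acts by [t], and at
    [k = 2i + 2], from where on [x_i] acts by [1]. *)
Local Notation lam k := (fun i : 'I_n =>
  FracField.tofrac (if (2 * i + 1 < k)%N then 1 else 'X : {poly K})).
Local Notation C k := [set i : 'I_n | (2 * i < k)%N].

(* The primes are, in increasing order, 0, (e_0), (x_0 - 1), (x_0 - 1, e_1),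
   (x_0 - 1, x_1 - 1), ..., where e_i := 1 - x_i y_i. *)
Lemma prime_chain_exists : has_prime_chain A (2 * n).
Proof.
have genA := gen_full SnA; have [rel univ] := SnA.
have lam0 k i : lam k i != 0.
  by rewrite tofrac_eq0; case: ifP => _; rewrite ?oner_eq0 ?polyX_eq0.
have ex_phi k : exists phi : A -> op K n, is_alg_hom phi /\
    forall i, phi (x i) = opX (C k) (lam k) i /\ phi (y i) = opY (C k) (lam k) i.
  by have [] := univ _ _ _ (op_relations (C k) (lam0 k)).
have [phi hphi] := choice ex_phi.
pose P k := vanishing (C k) (phi k).
have prP k : is_prime_ideal (P k).
  by have [h1 h2] := hphi k; apply: (vanishing_prime (lam0 k) genA h1 h2).
have Pe k i : P k (e x y i) <-> (2 * i < k)%N.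
  have [h1 h2] := hphi k; have := vanishing_e (lam0 k) h1 h2 i.
  by rewrite inE.
have Px k (i : 'I_n) : (2 * i + 1 < k)%N -> P k (x i - 1).
  move=> ik; have [h1 h2] := hphi k; apply: (vanishing_x1 h1 h2).
    by rewrite inE; lia.
  by rewrite ik tofrac1.
have PF k (j : 'I_n) F : (k <= 2 * j + 1)%N -> P k (horner_alg (x j) F) -> F = 0.
  move=> kj; have [h1 h2] := hphi k; apply: (vanishing_horner h1 h2) => _.
  by rewrite ltnNge kj.
exists P; split=> [k _|k kn]; first exact: prP.
(* Step [k] concerns [j = k./2]: it adds [e_j] for even [k] and [x_j - 1] for odd [k]. *)
have jn : (k./2 < n)%N by lia.
pose j := Ordinal jn; split.
  (* Here the larger prime [P k.+1] takes the place of [P], and [P k] that of [Q]. *)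
  apply: (prime_incl rel genA (C := [set i : 'I_n | (i <= j)%N]) (j := j)) => //.
  - by move=> i; rewrite inE /= => ij; rewrite !Pe; split; lia.
  - move=> i; rewrite !inE -val_eqE /= => /andP[ij ji].
    by split; apply: Px; lia.
  - by rewrite Pe /=; lia.
  - by move=> F; apply: PF => /=; lia.
case: (boolP (odd k)) => ok.
  exists (x j - 1); split; first by apply: Px => /=; lia.
  (* No nonzero polynomial in [x_j] lies in [P k], as [k = 2j + 1]. *)
  move=> h; have /eqP : 'X - 1%:P = 0 :> {poly K}; last by rewrite polyXsubC_eq0.
  by apply: (PF k j) => /=; [lia|rewrite rmorphB /= horner_algX horner_algC scale1r].
exists (e x y j); rewrite !Pe /=; split; lia.
Qed.

End LowerBound.

Theorem theorem4p10 (K : fieldType) (n : nat) (A : algType K)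
    (x y : 'I_n -> A) :
  (1 <= n)%N -> is_S_n x y -> classical_Krull_dim_eq A (2 * n).
Proof.
move=> _ SnA; split; first exact: prime_chain_exists SnA.
by move=> s; apply: (prime_chain_bound (proj1 SnA) (gen_full SnA)).
Qed.
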